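(* Assume the model $\varphi\sim Q$, $\Pi_j\mid\varphi\sim H^{(j)}_\varphi$ (independently over $j$ given $\varphi$), where the $H^{(j)}_\varphi$ are probability distributions on $\mathcal{P}(\Theta)$ with densities $h_j(\cdot\mid\varphi)$ as described in the context. Let $\Pi_1,\ldots,\Pi_J$ be distributional observations, and let $\bigl(\{H^{(j)}_\varphi : \varphi\in\Phi\}\bigr)_{j=1}^J$ be the corresponding family of marginals. Suppose that (i) $\Phi$ is a countable set (possibly finite). Furthermore, suppose $\varphi_0\in\Phi$ satisfies (ii) $Q(\varphi_0)>0$, and (iii) $\min_{\varphi\in\Phi\setminus\{\varphi_0\}}\operatorname{KL}\bigl(H^{(j)}_{\varphi_0};H^{(j)}_\varphi\bigr)>0$ for all $j$. Suppose also that for each $\varphi\neq\varphi_0$ the log-likelihood ratio terms $\xi_j:=\log\frac{h_j(\Pi_j\mid\varphi_0)}{h_j(\Pi_j\mid\varphi)}$, $j\ge1$, satisfy the following conditions: the random variables $(\xi_j)_{j\ge1}$ are independent, $\mathbb{E}(\xi_j)=\mu_j$ and $\operatorname{Var}(\xi_j)=\sigma_j^2$ exist for all $j\ge1$, and $\sum_{j\ge1}j^{-2}\sigma_j^2<\infty$. Then, when the observations are independent with $\Pi_j\sim H^{(j)}_{\varphi_0}$, the superposterior satisfies $Q^*(\varphi_0\mid\Pi_1,\ldots,\Pi_J)\to1$ with probability 1 as $J\to\infty$.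
   Context: $\Theta$ is a Borel space and $\mathcal{P}(\Theta)$ is the space of probability measures on $\Theta$. $\{p(\cdot\mid\varphi):\varphi\in\Phi\}$ is a family of probability densities on $\Theta$ with respect to a reference (Lebesgue or counting) measure. $Q$ is a (prior) probability measure on the parameter space $\Phi$; for a point $\varphi$, $Q(\varphi)$ denotes the mass of $\{\varphi\}$, and similarly for $Q^*$. For each $j\ge 1$ and $\varphi\in\Phi$, $H^{(j)}_\varphi$ is the probability distribution on $\mathcal{P}(\Theta)$ having density $h_j(\cdot\mid\varphi)=dH^{(j)}_\varphi/d\kappa$ with respect to a dominating measure $\kappa$ on $\mathcal{P}(\Theta)$, where (assuming integrability) $$h_j(\Pi_j\mid\varphi):=C_j\int_\Theta p(\theta_j\mid\varphi)\,\Pi_j(d\theta_j),$$ and $C_j$ is the normalizing factor such that $h_j$ integrates to 1. The superposterior is $$Q^*(B\mid\Pi_1,\ldots,\Pi_J)=\frac{\int_B\prod_{j=1}^J\left[\int_\Theta p(\theta_j\mid\varphi)\Pi_j(d\theta_j)\right]Q(d\varphi)}{\int_\Phi\prod_{j=1}^J\left[\int_\Theta p(\theta_j\mid\varphi)\Pi_j(d\theta_j)\right]Q(d\varphi)}=\frac{\int_B\prod_{j=1}^J h_j(\Pi_j\mid\varphi)\,Q(d\varphi)}{\int_\Phi\prod_{j=1}^J h_j(\Pi_j\mid\varphi)\,Q(d\varphi)}.$$ For probability distributions $\nu_0,\nu$ on the same space, $\operatorname{KL}(\nu_0;\nu)=\int\log\left(\frac{d\nu_0}{d\nu}\right)d\nu_0$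 if $\nu_0$ is absolutely continuous with respect to $\nu$, and $\operatorname{KL}(\nu_0;\nu)=\infty$ otherwise. Expectations and variances of the $\xi_j$ are taken under $\Pi_j\sim H^{(j)}_{\varphi_0}$. *)

(* Defs.v *)
From HB Require Import structures.
From mathcomp Require Import all_boot all_order all_algebra.
From mathcomp Require Import all_classical all_reals all_analysis.
From mathcomp Require Import measurable_realfun.

Set Implicit Arguments.
Unset Strict Implicit.
Unset Printing Implicit Defensive.

Import Order.TTheory GRing.Theory Num.Theory.
Import numFieldNormedType.Exports.

Local Open Scope classical_set_scope.
Local Open Scope ring_scope.
Local Open Scope ereal_scope.

(* T is isomorphic, as a measurable space, to a Borel subset of the real line:
   f is an isomorphism onto its range. *)
Definition borel_space (R : realType) d (T : measurableType d) : Prop :=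
  exists f : T -> R, [/\ injective f, measurable_fun [set: T] f &
    forall A : set T, measurable A -> measurable (f @` A)].

(* Mutual independence of a sequence of random elements. *)
Definition independent_RVs (R : realType) d d' (Omega : measurableType d)
    (T : measurableType d') (P : probability Omega R)
    (X : nat -> Omega -> T) : Prop :=
  forall (s : seq nat) (A : nat -> set T),
    uniq s -> (forall j, measurable (A j)) ->
    P (\bigcap_(j in [set` s]) (X j @^-1` A j)) =
    \prod_(j <- s) P (X j @^-1` A j).

Definition KL (R : realType) d (T : measurableType d)
    (nu0 nu : probability T R) : \bar R :=
  if pselect (nu0 `<< nu) then
    \int[nu0]_x lne (Radon_Nikodym (charge_of_finite_measure nu0) nu x)
  else +oo.

Lemma ratio_scale (R : realType) (c : R) (x y : \bar R) :
  (0 < c)%R -> 0 <= x -> 0 <= y -> (c%:E * x) / (c%:E * y) = x / y.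
Proof.
move=> c0 x0; have cy : c%:E * +oo = +oo by rewrite gt0_muley ?lte_fin.
have cn0 : c != 0%R by rewrite gt_eqF.
case: y => [y| |]// y0; last by rewrite cy !invey !mule0.
have [->|yn0] := eqVneq y 0%R.
  rewrite mule0 inve0; case: x x0 => [x| |]// x0; last by rewrite cy.
  have [->|xn0] := eqVneq x 0%R; first by rewrite mule0.
  have xp : (0 < x)%R by rewrite lt_neqAle eq_sym xn0 -lee_fin.
  by rewrite -EFinM !gt0_muley// lte_fin// mulr_gt0.
have yp : (0 < y)%R by rewrite lt_neqAle eq_sym yn0 -lee_fin.
rewrite -EFinM !inver mulf_eq0 (negbTE cn0) (negbTE yn0) /=.
case: x x0 => [x| |]// x0.
  by rewrite -!EFinM; congr (_%:E); rewrite -mulf_div divff// mul1r.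
by rewrite cy !gt0_mulye// lte_fin invr_gt0// mulr_gt0.
Qed.

Section superposterior.
Context (R : realType) (dT dP : measure_display).
Context (Theta : measurableType dT) (Phi : measurableType dP).
Variable p : Phi -> Theta -> R.

Definition marginal_lik (phi : Phi) (Pi : pprobability Theta R) : \bar R :=
  \int[Pi]_theta (p phi theta)%:E.

(* The index j : nat stands for the (j + 1)-st observation. The normalizing
   factor C j does not depend on phi. *)
Definition h (C : nat -> R) (j : nat) (phi : Phi) (Pi : pprobability Theta R)
    : \bar R :=
  (C j)%:E * marginal_lik phi Pi.

(* Extended-real valued: in \bar R, lne 0 = -oo, 0^-1 = +oo and 0 * +oo = 0, so
   the value is +oo where 0 = h phi < h phi0 and -oo where h phi0 = 0. *)
Definition log_lik_ratio (C : nat -> R) (j : nat) (phi0 phi : Phi)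
    (Pi : pprobability Theta R) : \bar R :=
  lne (h C j phi0 Pi / h C j phi Pi).

Variable Q : probability Phi R.

Definition superposterior (J : nat) (Pi : nat -> pprobability Theta R)
    (B : set Phi) : \bar R :=
  (\int[Q]_(phi in B) \prod_(j < J) marginal_lik phi (Pi j)) /
  (\int[Q]_phi \prod_(j < J) marginal_lik phi (Pi j)).

(* The superposterior may equivalently be computed with the densities h. *)
Lemma superposteriorE (C : nat -> R) (J : nat)
    (Pi : nat -> pprobability Theta R) (B : set Phi) :
  (forall j, (0 < C j)%R) -> (forall phi theta, (0 <= p phi theta)%R) ->
  measurable B ->
  measurable_fun [set: Phi]
    (fun phi => \prod_(j < J) marginal_lik phi (Pi j) : \bar R) ->
  superposterior J Pi B =
  (\int[Q]_(phi in B) \prod_(j < J) h C j phi (Pi j)) /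
  (\int[Q]_phi \prod_(j < J) h C j phi (Pi j)).
Proof.
move=> C0 p0 mB mf.
have f0 phi : 0 <= \prod_(j < J) marginal_lik phi (Pi j).
  by apply: prode_ge0 => j _; apply: integral_ge0 => theta _; rewrite lee_fin.
have hE phi : \prod_(j < J) h C j phi (Pi j) =
    (\prod_(j < J) C j)%:E * \prod_(j < J) marginal_lik phi (Pi j).
  by rewrite /h big_split/= prodEFin.
have c0 : (0 < \prod_(j < J) C j)%R by apply: prodr_gt0.
under [X in _ = X / _]eq_integral do rewrite hE.
under [X in _ = _ / X]eq_integral do rewrite hE.
rewrite !ge0_integralZl_EFin ?ltW//; last exact: measurable_funTS.
by rewrite ratio_scale//; apply: integral_ge0.
Qed.

End superposterior.

(* Main.v *)
Require Import Defs.
From HB Require Import structures.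
From mathcomp Require Import all_boot all_order all_algebra.
From mathcomp Require Import all_classical all_reals all_analysis.
From mathcomp Require Import measurable_realfun.
From mathcomp Require Import ring lra.

Import Order.TTheory GRing.Theory Num.Theory.
Import numFieldNormedType.Exports.

Local Open Scope classical_set_scope.
Local Open Scope ring_scope.
Local Open Scope ereal_scope.

(** The normalizing factors satisfy [C j = C 0], so the observations are
    i.i.d. and the products of likelihood ratios over the observations are
    nonnegative supermartingales with mean at most [1]. For a fixed
    [phi <> phi0] the ratio product tends to [0] exponentially fast: distinct
    laws have Hellinger affinity below [1], so the product of the square roots
    of the ratios, divided by [rho ^+ n] for some [rho < 1], is again a
    supermartingale, hence bounded. As the convergence need not be uniform in
    [phi], the maximal inequality is also applied to the mixture of the ratio
    products over a [Q]-small tail of [Phi]: it makes the contribution of the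
    tail small simultaneously for all sample sizes. *)

(** * Integration tools: densities, joint laws, countable parameter spaces *)

Section density.
Import HBNNSimple.

(** The defining identity on sets extends to simple functions by linearity, then to [g] by monotone
    convergence along [nnsfun_approx] on both sides. As [f] is real-valued, multiplication by [f x]
    preserves limits in [\bar R]. *)
Lemma ge0_integral_density {d} {T : measurableType d} {R : realType}
    (mu nu : {measure set T -> \bar R}) (f : T -> R) (g : T -> \bar R) :
  measurable_fun setT f -> (forall x, (0 <= f x)%R) ->
  (forall A, measurable A -> nu A = \int[mu]_(x in A) (f x)%:E) ->
  measurable_fun setT g -> (forall x, 0 <= g x) ->
  \int[nu]_x g x = \int[mu]_x (g x * (f x)%:E).
Proof.
move=> mf f0 nuE mg g0.
pose h := nnsfun_approx measurableT mg.
have hg x : (EFin \o h n) x @[n --> \oo] --> g x.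
  by apply: (@cvg_nnsfun_approx _ _ _ setT).
have hnd x a b : (a <= b)%N -> (h a x <= h b x)%R.
  by move=> ab; exact/lefP/nd_nnsfun_approx.
transitivity (lim (\int[nu]_x (EFin \o h n) x @[n --> \oo])).
  rewrite -monotone_convergence//.
  - by apply: eq_integral => x _; apply/esym/cvg_lim.
  - by move=> n; apply/measurable_EFinP.
  - by move=> n x _; rewrite lee_fin.
  - by move=> x _ a b ab; rewrite lee_fin hnd.
transitivity (lim (\int[mu]_x ((EFin \o h n) x * (f x)%:E) @[n --> \oo]));
    last first.
  rewrite -monotone_convergence//.
  - by apply: eq_integral => x _; apply/cvg_lim => //; exact: cvgeZr.
  - by move=> n; apply: emeasurable_funM; exact/measurable_EFinP.
  - by move=> n x _; rewrite mule_ge0// lee_fin.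
  - by move=> x _ a b ab; rewrite lee_wpmul2r ?lee_fin ?hnd.
congr (limn _); apply/funext => n.
rewrite integralT_nnsfun sintegralE.
transitivity (\int[mu]_x
    (\sum_(y \in range (h n)) (y * \1_(h n @^-1` [set y]) x)%:E * (f x)%:E)).
  rewrite ge0_integral_fsum//.
  - apply: eq_fsbigr => r /[!inE] -[t _ rt].
    have r0 : (0 <= r)%R by rewrite -rt.
    rewrite nuE//.
    under [RHS]eq_integral do rewrite EFinM -muleA.
    rewrite ge0_integralZl//.
    + congr (_ * _); rewrite integral_mkcond; apply: eq_integral => x _.
      by rewrite epatch_indic muleC.
    + by apply: emeasurable_funM; exact/measurable_EFinP.
    + by move=> x _; rewrite mule_ge0// lee_fin.
  - by move=> r; apply: emeasurable_funM; apply/measurable_EFinP => //;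
      exact: measurable_funM.
  - move=> r x _; rewrite mule_ge0 ?lee_fin//.
    by rewrite -lee_fin EFinM nnfun_muleindic_ge0.
apply: eq_integral => x _ /=.
rewrite -ge0_mule_fsuml => [|y].
  by rewrite fsumEFin// -fimfunE.
by rewrite EFinM nnfun_muleindic_ge0.
Qed.

End density.

(** The rectangle hypothesis identifies the joint law of [(Y, Z)] with the product of the two laws,
    and Tonelli's theorem then splits the integral. The target of [Y] is arbitrary, so [Y] can be
    the identity into a coarser sigma-algebra, which encodes independence from a whole past. *)
Lemma ge0_expectation_prod {R : realType} {d dU dV} {O : measurableType d}
    {U : measurableType dU} {V : measurableType dV} (P : probability O R)
    (Y : O -> U) (Z : O -> V) (f : U -> \bar R) (g : V -> \bar R) :
  measurable_fun setT Y -> measurable_fun setT Z ->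
  (forall A B, measurable A -> measurable B ->
     P (Y @^-1` A `&` Z @^-1` B) = P (Y @^-1` A) * P (Z @^-1` B)) ->
  measurable_fun setT f -> measurable_fun setT g ->
  (forall u, 0 <= f u) -> (forall v, 0 <= g v) ->
  \int[P]_w (f (Y w) * g (Z w)) = \int[P]_w f (Y w) * \int[P]_w g (Z w).
Proof.
move=> mY mZ YZ mf mg f0 g0.
pose YY : {RV P >-> U} := HB.pack Y (isMeasurableFun.Build _ _ _ _ Y mY).
pose ZZ : {RV P >-> V} := HB.pack Z (isMeasurableFun.Build _ _ _ _ Z mZ).
have mYZ : measurable_fun setT (fun w => (Y w, Z w)).
  exact: measurable_fun_pair.
pose YZ' : {RV P >-> (U * V)%type} :=
  HB.pack (fun w => (Y w, Z w)) (isMeasurableFun.Build _ _ _ _ _ mYZ).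
have E X : measurable X ->
    (distribution P YY \x distribution P ZZ) X = distribution P YZ' X.
  by apply: product_measure_unique => A B mA mB; rewrite -YZ.
have mfg : measurable_fun setT (fun z : U * V => f z.1 * g z.2).
  by apply: emeasurable_funM; exact: measurableT_comp.
have fg0 (z : U * V) : 0 <= f z.1 * g z.2 by rewrite mule_ge0.
transitivity (\int[distribution P YZ']_z (f z.1 * g z.2)).
  by rewrite ge0_integral_distribution.
transitivity (\int[distribution P YY \x distribution P ZZ]_z (f z.1 * g z.2)).
  by apply: eq_measure_integral => A mA _; exact/esym/E.
rewrite fubini_tonelli1//= /fubini_F/=.
under eq_integral do rewrite ge0_integralZl//.
rewrite ge0_integralZr ?integral_ge0//.
by rewrite !ge0_integral_distribution.
Qed.

(** Supplies the joint measurability required by Tonelli's theorem: a preimage is a countable union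
    of rectangles over singletons of [Phi]. *)
Lemma measurable_fun_countable_prod {R : realType} {dP dT}
    {Phi : measurableType dP} {T : measurableType dT}
    (f : Phi -> T -> \bar R) :
  countable [set: Phi] -> (forall phi : Phi, measurable [set phi]) ->
  (forall phi, measurable_fun setT (f phi)) ->
  measurable_fun setT (fun z : Phi * T => f z.1 z.2).
Proof.
move=> cPhi mpt mf _ B mB; rewrite setTI.
have -> : (fun z : Phi * T => f z.1 z.2) @^-1` B =
    \bigcup_(phi in setT) ([set phi] `*` (f phi @^-1` B)).
  apply/seteqP; split => [[phi t] /= ?|[phi t] /= [psi _ [/= <- //]]].
  by exists phi.
apply: countable_bigcupT_measurable => // phi.
by apply: measurableX => //; rewrite -[X in measurable X]setTI; exact: mf.
Qed.

Lemma measurable_countableT {dP} {Phi : measurableType dP} (A : set Phi) :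
  countable [set: Phi] -> (forall phi : Phi, measurable [set phi]) ->
  measurable A.
Proof.
move=> cPhi mpt; apply: countable_measurable => //.
exact: sub_countable (subset_card_le (@subsetT _ A)) cPhi.
Qed.

(** * Independence of past and future, and maximal inequalities *)

(** A pi-system that generates the sigma-algebra of the observations [X i] with [i < n]. *)
Definition cylinders {d dT} {O : measurableType d} {T : measurableType dT}
    (X : nat -> O -> T) (n : nat) : set (set O) :=
  [set B | exists2 A : nat -> set T, (forall j, measurable (A j)) &
     B = \bigcap_(j in [set` iota 0 n]) (X j @^-1` A j)].

(** Both sides are finite measures in [B]. They agree on the pi-system [cylinders X n], hence on the
    sigma-algebra that it generates. *)
Lemma independent_future {R : realType} {d dT} {O : measurableType d}
    {T : measurableType dT} (P : probability O R) (X : nat -> O -> T) n A B :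
  (forall j, measurable_fun setT (X j)) -> independent_RVs P X ->
  <<s cylinders X n >> B -> measurable A ->
  P (B `&` X n @^-1` A) = P B * P (X n @^-1` A).
Proof.
move=> mX iX GB mA.
have mXA j C : measurable C -> measurable (X j @^-1` C).
  by move=> mC; rewrite -[X in measurable X]setTI; exact: mX.
have PA_ge0 : (0 <= fine (P (X n @^-1` A)))%R by rewrite fine_ge0.
pose c : {nonneg R} := NngNum PA_ge0.
have cE : c%:num%:E = P (X n @^-1` A).
  by rewrite /= fineK// fin_num_measure//; exact: mXA.
have GT : cylinders X n setT.
  by exists (fun=> setT) => //; apply/esym/seteqP; split.
pose m1 := mrestr P (mXA n A mA); pose m2 := mscale c P.
suff : m1 B = m2 B by rewrite /m1 /m2 /mrestr /mscale/= -cE muleC.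
apply: (@g_sigma_algebra_measure_unique _ _ _ (cylinders X n) _ (fun=> setT)
  _ _ m1 m2 _ _ _ _ GB) => //.
- move=> C [D mD ->]; apply: fin_bigcap_measurable => // j _.
  exact: (mXA j (D j)).
- by rewrite bigcup_const//; exists 0%N.
- move=> _ _ [C mC ->] [D mD ->].
  exists (fun j => C j `&` D j); first by move=> j; exact: measurableI.
  by rewrite -bigcapI.
- move=> C [D mD ->].
  transitivity (P (\bigcap_(j in [set` iota 0 n]) X j @^-1` D j) *
      P (X n @^-1` A)); last by rewrite /m2 /mscale/= -cE muleC.
  rewrite -[LHS]/(P (_ `&` _)).
  (* Imposing [A] on coordinate [n] turns the intersection into a cylinder over [iota 0 n.+1], to
     which [independent_RVs] applies. *)
  pose D' j := if j == n then A else D j.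
  have mD' j : measurable (D' j) by rewrite /D'; case: ifPn.
  have -> : \bigcap_(j in [set` iota 0 n]) (X j @^-1` D j) `&` X n @^-1` A =
      \bigcap_(j in [set` iota 0 n.+1]) (X j @^-1` D' j).
    have memI k j : [set` iota 0 k] j -> (j < k)%N by rewrite /= mem_iota.
    have Imem k j : (j < k)%N -> [set` iota 0 k] j by rewrite /= mem_iota.
    apply/seteqP; split => [w [] h1 h2 j|w h].
      move/memI; rewrite ltnS leq_eqVlt /D'.
      by case: eqP => [-> //|_ /=] jn; exact/h1/Imem.
    split => [j /memI jn|].
      by have := h j (Imem _ _ (leqW jn)); rewrite /D' (ltn_eqF jn).
    by have := h n (Imem _ _ (ltnSn n)); rewrite /D' eqxx.
  rewrite iX ?iota_uniq// iX ?iota_uniq// -addn1 iotaD big_cat/= big_seq1.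
  rewrite add0n {2}/D' eqxx; congr (_ * _).
  apply: eq_big_seq => j; rewrite mem_iota add0n /= => jn.
  by rewrite /D' (ltn_eqF jn).
- move=> _; rewrite -[X in X < _]/(P (_ `&` _)) setTI.
  by rewrite (le_lt_trans (probability_le1 _ _)) ?ltry//; exact: (mXA n).
Qed.

(* [M] need not be a supermartingale for the filtration it generates: only the
   events that it has stayed below the level are tested. *)
Lemma doob_maximal_inequality {R : realType} {d} {O : measurableType d}
    (P : probability O R) (M : nat -> O -> \bar R) (e : R) :
  (0 <= e)%R ->
  (forall n, measurable_fun setT (M n)) -> (forall n w, 0 <= M n w) ->
  (forall n,
     \int[P]_(w in [set w | forall j, (j <= n)%N -> M j w < e%:E]) M n.+1 w <=
     \int[P]_(w in [set w | forall j, (j <= n)%N -> M j w < e%:E]) M n w) ->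
  e%:E * P (\bigcup_n [set w | e%:E <= M n w]) <= \int[P]_w M 0%N w.
Proof.
move=> e0 mM M0 superM.
pose A n := [set w | e%:E <= M n w].
have mA n : measurable (A n).
  by rewrite -[A n]setTI; exact: emeasurable_fun_c_infty.
pose E n := \bigcup_(j in `I_n) A j.
have mE n : measurable (E n) by exact: bigcup_measurable.
have ES n : E n.+1 = E n `|` (A n `\` E n).
  by rewrite {1}/E IIS bigcup_setU bigcup_set1 setUDr setDv setD0.
have mD n : measurable (A n `\` E n) by exact: measurableD.
have CES n : ~` E n = (A n `\` E n) `|` ~` E n.+1.
  rewrite ES; apply/seteqP; split => [w nE|w /= [[//]|nE ?]]; last first.
    by apply: nE; left.
  have [Aw|nA] := pselect (A n w); first by left.
  by right => -[//|[]].
(* [E n] is the event that the level is reached before time [n]. In passing to [n.+1] the integral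
   loses the part over [A n] minus [E n], where [M n] is at least [e]: this pays for the growth of
   [P (E n)]. On what remains, [superM] replaces [M n] by [M n.+1]. *)
have H n : e%:E * P (E n) + \int[P]_(w in ~` E n) M n w <= \int[P]_w M 0%N w.
  elim: n => [|n IH].
    by rewrite /E II0 bigcup_set0 measure0 mule0 add0e setC0.
  apply: le_trans IH.
  have PES : P (E n.+1) = P (E n) + P (A n `\` E n).
    by rewrite ES measureU// setDIK.
  rewrite PES muleDr//; last by rewrite ge0_adde_def ?inE.
  rewrite -addeA leeD2l// (CES n) ge0_integral_setU//; last 3 first.
  - exact: measurableC.
  - exact: measurable_funTS.
  - by apply/disj_setPS => w [] ? []; rewrite ES; right.
  rewrite leeD//.
    have -> : e%:E * P (A n `\` E n) = \int[P]_(w in A n `\` E n) e%:E.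
      by rewrite integral_cst.
    apply: ge0_le_integral => //.
    - exact: measurable_funTS.
    - by move=> w [].
  have := superM n.
  suff -> : [set w | forall j, (j <= n)%N -> M j w < e%:E] = ~` E n.+1 by [].
  apply/seteqP; split => w /= => [h [j /= jn]|h j jn].
    by rewrite /A/= leNgt h.
  by rewrite ltNge; apply/negP => ej; apply: h; exists j.
have -> : \bigcup_n A n = \bigcup_n E n.
  apply/seteqP; split => w [n _ An]; first by exists n.+1 => //; exists n => /=.
  by case: An => j _ ?; exists j.
have : e%:E * P (E n) @[n --> \oo] --> e%:E * P (\bigcup_n E n).
  apply: cvgeZl => //; apply: nondecreasing_cvg_mu => //.
    exact: bigcup_measurable.
  move=> m n mn; apply/subsetPset => w [j /= jm ?]; exists j => //=.
  exact: leq_trans mn.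
move=> cv; rewrite -(cvg_lim _ cv)//; apply: lime_le.
  by apply/cvg_ex; eexists; exact: cv.
apply: nearW => n; apply: le_trans (H n).
by rewrite leeDl// integral_ge0.
Qed.

Section mixture.
Context {R : realType} {dP dT : measure_display}.
Context {Phi : measurableType dP} {T : measurableType dT}.
Variables (Q : {sigma_finite_measure set Phi -> \bar R}).
Variables (g : Phi -> T -> R) (u : Phi -> R).
Hypothesis cPhi : countable [set: Phi].
Hypothesis mPhi : forall phi : Phi, measurable [set phi].
Hypothesis mg : forall phi, measurable_fun setT (g phi).
Hypothesis g0 : forall phi t, (0 <= g phi t)%R.
Hypothesis u0 : forall phi, (0 <= u phi)%R.

Let term {O : Type} (X : nat -> O -> T) n phi w : R :=
  (u phi * \prod_(i < n) g phi (X i w))%R.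

Let term0 {O : Type} (X : nat -> O -> T) n phi w : (0 <= term X n phi w)%R.
Proof. by rewrite mulr_ge0// prodr_ge0. Qed.

Let measurable_term {d} {O : measurableType d} (X : nat -> O -> T) n phi :
  (forall i, (i < n)%N -> measurable_fun setT (X i)) ->
  measurable_fun setT (term X n phi).
Proof.
move=> mX; apply: measurable_funM => //.
apply: measurable_prod => i _; apply: measurableT_comp => //; exact: mX.
Qed.

Let measurable_mixture {d} {O : measurableType d} (X : nat -> O -> T) n :
  (forall i, (i < n)%N -> measurable_fun setT (X i)) ->
  measurable_fun setT (fun w => \int[Q]_phi (term X n phi w)%:E).
Proof.
move=> mX.
apply: (measurable_fun_fubini_tonelli_G
  (fun z : Phi * O => (term X n z.1 z.2)%:E)).
- apply: (measurable_fun_countable_prod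
    (fun phi w => (term X n phi w)%:E)) => //.
  by move=> phi; apply/measurable_EFinP; exact: measurable_term.
- by move=> z; rewrite lee_fin term0.
Qed.

(** The mixture starts at the constant on the right and decreases in mean on every past event: by
    Tonelli's theorem this can be checked for each [phi], where the new factor is independent of the
    past and has mean at most [1]. It serves once with a Dirac [Q], for a single parameter, and once
    with [u] the indicator of a tail of [Phi]. *)
Lemma mixture_maximal_inequality {d} {O : measurableType d}
    (P : probability O R) (X : nat -> O -> T) (e : R) :
  (forall j, measurable_fun setT (X j)) -> independent_RVs P X ->
  (forall n phi, \int[P]_w (g phi (X n w))%:E <= 1) -> (0 <= e)%R ->
  e%:E * P (\bigcup_n [set w | e%:E <=
     \int[Q]_phi (u phi * \prod_(i < n) g phi (X i w))%:E]) <=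
  \int[Q]_phi (u phi)%:E.
Proof.
move=> mX iX g1 e0.
pose M n w := \int[Q]_phi (term X n phi w)%:E.
have -> : \int[Q]_phi (u phi)%:E = \int[P]_w M 0%N w.
  rewrite -[LHS]mule1 -(probability_setT P) -integral_cst//.
  apply: eq_integral => w _; apply: eq_integral => phi _.
  by rewrite /term big_ord0 mulr1.
apply: (doob_maximal_inequality P M e) => //.
- by move=> n; exact: measurable_mixture.
- by move=> n w; apply: integral_ge0 => phi _; rewrite lee_fin term0.
move=> n; set S := [set w | _].
(* [F] is [O] with the sigma-algebra of the first [n] observations. The event [S] lives there, since
   it constrains [M j] for [j <= n] only and [M j] reads only [X i] with [i < j]. *)
pose F := g_sigma_algebraType (cylinders X n).
have mXF i : (i < n)%N -> measurable_fun setT (X i : F -> T).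
  move=> ni _ A mA; apply: sub_sigma_algebra; rewrite setTI.
  exists (fun j => if j == i then A else setT).
    by move=> j; case: ifP.
  apply/seteqP; split => [w Aw j _|w]; first by case: eqP => // ->.
  by move=> /(_ i); rewrite eqxx; apply; rewrite /= mem_iota.
have FO (A : set F) : measurable A -> d.-measurable (A : set O).
  apply: smallest_sub; first exact: sigma_algebra_measurable.
  move=> _ [B mB ->]; apply: fin_bigcap_measurable => // j _.
  by rewrite -[X in measurable X]setTI; exact: mX.
have mSF : measurable (S : set F).
  have -> : S = \bigcap_(j in `I_n.+1) [set w | M j w < e%:E].
    by apply/seteqP; split => w h j; exact: h.
  apply: fin_bigcap_measurable => // j jn.
  rewrite -[X in measurable X]setTI; apply: emeasurable_fun_infty_o => //.
  by apply: measurable_mixture => i ij; apply: mXF; exact: leq_trans ij _.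
have mS : measurable S by exact: FO.
have m1S d' (O' : measurableType d') (S' : set O') : measurable S' ->
    measurable_fun setT (fun w => (\1_S' w)%:E : \bar R).
  by move=> mS'; apply/measurable_EFinP; exact: measurable_indic.
have mK k phi :
    measurable_fun setT (fun w => (\1_S w)%:E * (term X k phi w)%:E).
  apply: emeasurable_funM; first exact: m1S.
  by apply/measurable_EFinP; exact: measurable_term.
have K0 k phi w : 0 <= (\1_S w)%:E * (term X k phi w)%:E.
  by rewrite mule_ge0 ?lee_fin// term0.
have mKK k : measurable_fun setT
    (fun z : Phi * O => (\1_S z.2)%:E * (term X k z.1 z.2)%:E).
  exact: (measurable_fun_countable_prod
    (fun phi w => (\1_S w)%:E * (term X k phi w)%:E)).
have swap k : \int[P]_(w in S) M k w =
    \int[Q]_phi \int[P]_w ((\1_S w)%:E * (term X k phi w)%:E).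
  rewrite (fubini_tonelli
    (fun z : Phi * O => (\1_S z.2)%:E * (term X k z.1 z.2)%:E))//=.
  rewrite integral_mkcond; apply: eq_integral => w _.
  rewrite epatch_indic muleC ge0_integralZl//.
  - by move=> _ B _; exact: measurable_countableT.
  - by move=> phi _; rewrite lee_fin term0.
rewrite !swap; apply: ge0_le_integral => //.
- by move=> phi ?; apply: integral_ge0 => w ?; exact: K0.
- by move=> ? B ?; exact: measurable_countableT.
- by move=> ? B ?; exact: measurable_countableT.
move=> phi ?.
under eq_integral do rewrite /term big_ord_recr/= mulrA EFinM muleA.
(* The past enters as the identity from [O] to [F], and [independent_future] gives the rectangle
   hypothesis against [X n]. *)
rewrite (@ge0_expectation_prod _ _ _ _ _ F _ P id (X n)
  (fun w => (\1_S w)%:E * (term X n phi w)%:E) (fun t => (g phi t)%:E))//.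
- by rewrite -[leRHS]mule1 lee_wpmul2l ?integral_ge0 ?g1// => w ?; exact: K0.
- by move=> ? A mA; rewrite setTI; exact: FO.
- by move=> A B mA mB; exact: independent_future.
- apply: emeasurable_funM; first exact: m1S.
  by apply/measurable_EFinP; exact: measurable_term.
- by apply/measurable_EFinP.
- by move=> t; rewrite lee_fin.
Qed.
End mixture.

(** * Likelihood ratios and the Hellinger affinity *)

Section likelihood_ratio.
Context {R : realType} {d} {T : measurableType d}.
Variables (mu : {measure set T -> \bar R}) (nu0 nu1 : probability T R).
Variables (f0 f1 : T -> R).
Hypothesis mf0 : measurable_fun setT f0.
Hypothesis mf1 : measurable_fun setT f1.
Hypothesis f0_ge0 : forall t, (0 <= f0 t)%R.
Hypothesis f1_ge0 : forall t, (0 <= f1 t)%R.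
Hypothesis nu0E : forall A, measurable A -> nu0 A = \int[mu]_(x in A) (f0 x)%:E.
Hypothesis nu1E : forall A, measurable A -> nu1 A = \int[mu]_(x in A) (f1 x)%:E.

(** Where [f0] vanishes, division by zero makes [r] equal to [0]; by [density_neq0] this happens on
    a [nu0]-null set. *)
Let r t : R := (f1 t / f0 t)%R.

Lemma measurable_likelihood_ratio : measurable_fun setT r.
Proof.
rewrite (_ : r = (fun t => f1 t * f0 t `^ (-1))%R).
  apply: measurable_funM => //.
  exact: (measurableT_comp (measurable_powR _)).
by apply/funext => t; rewrite powR_inv1.
Qed.

Let r_ge0 t : (0 <= r t)%R. Proof. exact: divr_ge0. Qed.
Let mr := measurable_likelihood_ratio.

Lemma density_neq0 : nu0 [set t | f0 t = 0%R] = 0.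
Proof.
have mA : measurable [set t | f0 t = 0%R].
  rewrite -[X in measurable X]setTI; exact: (mf0 measurableT [set 0%R]).
by rewrite nu0E// integral0_eq// => t ->.
Qed.

(** [r * f0] equals [f1] where [f0] is nonzero and [0] elsewhere, so any [nu1]-mass of [A] on the
    zero set of [f0] is lost. *)
Lemma integral_likelihood_ratio_le A : measurable A ->
  \int[nu0]_(t in A) (r t)%:E <= nu1 A.
Proof.
move=> mA; rewrite integral_mkcond.
rewrite (ge0_integral_density mu nu0 f0)//.
- rewrite nu1E// [leRHS]integral_mkcond; apply: ge0_le_integral => //.
  + move=> t _; rewrite mule_ge0 ?erestrict_ge0 ?lee_fin// => x _.
    by rewrite lee_fin.
  + apply: emeasurable_funM; last exact/measurable_EFinP.
    apply/(measurable_restrictT _ mA)/measurable_funTS/measurable_EFinP.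
    exact: mr.
  + exact/(measurable_restrictT _ mA)/measurable_funTS/measurable_EFinP.
  + move=> t _; rewrite !patchE; case: ifPn => _; last by rewrite mul0e.
    rewrite -EFinM lee_fin /r; have [->|f00] := eqVneq (f0 t) 0%R.
      by rewrite mulr0.
    by rewrite divfK.
- apply/(measurable_restrictT _ mA)/measurable_funTS/measurable_EFinP.
  exact: mr.
- by move=> t; rewrite erestrict_ge0// => x _; rewrite lee_fin.
Qed.

(* If the Hellinger affinity were 1, then the integral of (1 - sqrt r)^2 would
   vanish. *)
Lemma hellinger_affinity_lt1 (A : set T) : measurable A -> nu0 A != nu1 A ->
  \int[nu0]_t (Num.sqrt (r t))%:E < 1.
Proof.
move=> mA nA; rewrite ltNge; apply: contraNN nA => s1.
have ms : measurable_fun setT (fun t => Num.sqrt (r t)).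
  apply: measurableT_comp; last exact: mr.
  by apply: continuous_measurable_fun => x; exact: sqrt_continuous.
pose q t : R := ((1 - Num.sqrt (r t)) ^+ 2)%R.
have mq : measurable_fun setT q.
  by apply: measurable_funX; exact: measurable_funB.
have q0 : \int[nu0]_t (q t)%:E = 0.
  apply/eqP; rewrite eq_le integral_ge0 ?andbT; last first.
    by move=> t _; rewrite lee_fin sqr_ge0.
  (* The identity [(1 - s)^2 + 2 s = 1 + s^2] with [s] the square root of [r] is integrated in this
     additive form, so that all terms are nonnegative and no integrability is required. *)
  have : \int[nu0]_t (q t)%:E + 2%:E * \int[nu0]_t (Num.sqrt (r t))%:E <= 1 + 1.
    have q_ge0 t : [set: T] t -> 0 <= (q t)%:E by rewrite lee_fin sqr_ge0.
    have mqE : measurable_fun setT (fun t => (q t)%:E).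
      exact/measurable_EFinP.
    have msE : measurable_fun setT (fun t => (Num.sqrt (r t))%:E).
      exact/measurable_EFinP.
    have s2 t : [set: T] t -> 0 <= 2%:E * (Num.sqrt (r t))%:E.
      by rewrite mule_ge0// lee_fin.
    have ms2 : measurable_fun setT (fun t => 2%:E * (Num.sqrt (r t))%:E).
      exact: measurable_funeM.
    rewrite -ge0_integralZl// -ge0_integralD//.
    under eq_integral => t _.
      rewrite -EFinM -EFinD (_ : _ + _ = 1 + r t)%R; last first.
        by rewrite /q -[in RHS](sqr_sqrtr (r_ge0 t)); ring.
      rewrite EFinD; over.
    rewrite ge0_integralD//.
    - have -> : \int[nu0]_t 1 = 1 :> \bar R.
        by rewrite integral_cst// mul1e [LHS]probability_setT.
      rewrite leeD2l//.
      rewrite -[leRHS](probability_setT nu1).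
      exact: integral_likelihood_ratio_le.
    - by move=> t _; rewrite lee_fin.
    - by apply/measurable_EFinP; exact: mr.
  move=> h.
  have : \int[nu0]_t (q t)%:E + 2%:E * 1 <= 2%:E * 1.
    apply: (le_trans (y := \int[nu0]_t (q t)%:E +
      2%:E * \int[nu0]_t (Num.sqrt (r t))%:E)).
      by rewrite leeD2l// lee_wpmul2l.
    by rewrite (le_trans h)// mule1 -EFinD.
  by rewrite -leeBrDr// subee.
have r1 : ae_eq nu0 setT (EFin \o r) (cst 1).
  have /(ae_eq_integral_abs nu0 measurableT) : measurable_fun setT (EFin \o q).
    exact/measurable_EFinP.
  case=> + _; have -> : \int[nu0]_t `|(EFin \o q) t| = 0.
    rewrite -[RHS]q0; apply: eq_integral => t _.
    by rewrite gee0_abs// lee_fin sqr_ge0.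
  move=> /(_ erefl); apply: filterS => t /(_ I) /= [/eqP].
  rewrite sqrf_eq0 subr_eq0 => /eqP sr _; congr EFin.
  by rewrite -[LHS]sqr_sqrtr// -sr expr1n.
(* Since both total masses are [1], domination on the complement of [A] gives the reverse inequality
   on [A]. Domination itself holds because [r] is [1] almost everywhere, so that [nu0 B] is the
   integral of [r] over [B]. *)
suff H B : measurable B -> nu0 B <= nu1 B.
  rewrite eq_le H//=.
  have := H _ (measurableC mA); rewrite !probability_setC//.
  rewrite -(@fineK _ (nu0 A)) ?fin_num_measure//.
  rewrite -(@fineK _ (nu1 A)) ?fin_num_measure//.
  by rewrite -!EFinB !lee_fin lerD2l lerN2.
move=> mB.
apply: le_trans (integral_likelihood_ratio_le _ mB).
rewrite (ae_eq_integral (cst 1))//.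
- by rewrite integral_cst// mul1e.
- by apply: measurable_funTS; apply/measurable_EFinP; exact: mr.
- exact: ae_eq_subset r1.
Qed.

End likelihood_ratio.

(** * Vanishing divergence, limits at zero and almost sure events *)

(** Its contrapositive turns a nonzero divergence into a set that separates the two laws. For equal
    laws the Radon-Nikodym derivative is [1] almost everywhere, and its logarithm vanishes there. *)
Lemma KL_eq0 {R : realType} {d} {T : measurableType d}
    (nu0 nu1 : probability T R) :
  (forall A, measurable A -> nu0 A = nu1 A) -> KL nu0 nu1 = 0.
Proof.
move=> nu01; rewrite /KL; case: pselect => [dom|]; last first.
  by case; apply/null_content_dominatesP => A mA A0; rewrite [LHS]nu01.
pose rn := Radon_Nikodym (charge_of_finite_measure nu0) nu1.
have h : ae_eq nu1 setT rn (cst 1).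
  apply: integral_ae_eq => //.
  - exact: Radon_Nikodym_integrable.
  - move=> A _ mA; rewrite -Radon_Nikodym_integral// integral_cst// mul1e.
    exact: nu01.
have h0 : ae_eq nu0 setT rn (cst 1).
  exact: null_dominates_ae_eq h.
transitivity (\int[nu0]_(x in setT) cst 0 x); last by rewrite integral0.
apply: ae_eq_integral => //.
  have frn x : rn x \is a fin_num by exact: Radon_Nikodym_fin_num.
  have mrn : measurable_fun setT rn.
    exact/measurable_int/Radon_Nikodym_integrable.
  (* The derivative is finite everywhere, so its [lne] can be written by cases on [fine (rn x)], a
     form whose measurability is direct. *)
  rewrite (_ : (fun x => _) = (fun x =>
    if (fine (rn x) <= 0)%R then -oo else (ln (fine (rn x)))%:E)); last first.
    by apply/funext => x; have := frn x; rewrite /rn; case: Radon_Nikodym.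
  have mfrn : measurable_fun setT (fine \o rn) by exact: measurableT_comp.
  apply: measurable_fun_ifT => //.
    by apply: measurable_fun_ler.
  by apply/measurable_EFinP; exact: measurableT_comp.
by apply: filterS h0 => x /(_ I) /= + _; rewrite /rn => ->; rewrite lne1.
Qed.

Lemma cvge0_ge0P {R : realType} (v : nat -> \bar R) : (forall n, 0 <= v n) ->
  (forall e : R, (0 < e)%R -> \forall n \near \oo, v n <= e%:E) ->
  v @ \oo --> 0.
Proof.
move=> v0 ve; apply/fine_cvgP; split.
  apply: filterS (ve 1%R ltr01) => n vn.
  by rewrite ge0_fin_numE// (le_lt_trans vn)// ltry.
apply/cvgr0Pnorm_le => e e0; apply: filterS (ve e e0) => n vn.
rewrite ger0_norm ?fine_ge0// -lee_fin fineK//.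
by rewrite ge0_fin_numE// (le_lt_trans vn)// ltry.
Qed.

(** The intersection of all [A k] is null. This converts the probability bounds of the maximal
    inequality into almost sure bounds with an index that depends on the outcome. *)
Lemma ae_exists_notin {R : realType} {d} {O : measurableType d}
    (P : probability O R) (A : nat -> set O) :
  (forall k, measurable (A k)) ->
  (forall e : R, (0 < e)%R -> exists k, P (A k) <= e%:E) ->
  {ae P, forall w, exists k, ~ A k w}.
Proof.
move=> mA PA; exists (\bigcap_k A k); split.
- exact: bigcapT_measurable.
- apply/eqP; rewrite eq_le measure_ge0 andbT; apply/lee_addgt0Pr => e e0.
  rewrite add0e; have [k] := PA e e0; apply: le_trans.
  rewrite le_measure ?inE//; first exact: bigcapT_measurable.
  by move=> w; apply.
- by move=> w /= + k _; apply: contra_notP => ?; exists k.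
Qed.

Lemma ae_forall_countable {R : realType} {d} {T : measurableType d} {I : Type}
    (mu : {measure set T -> \bar R}) (F : I -> T -> Prop) :
  countable [set: I] -> (forall i, {ae mu, forall x, F i x}) ->
  {ae mu, forall x, forall i, F i x}.
Proof.
move=> /countable_injP[idx /in2TT idxI] H.
have : {ae mu, forall x, forall m i, idx i = m -> F i x}.
  apply: ae_foralln => m.
  have [[i <-]|N] := pselect (exists i, idx i = m).
    by apply: filterS (H i) => x Fx j /idxI ->.
  by apply: aeW => x i im; exfalso; apply: N; exists i.
by apply: filterS => x Fx i; exact: Fx erefl.
Qed.

(** * Almost sure decay of the ratio products for one parameter *)

Section iid.
Context {R : realType} {d dT : measure_display}.
Context {O : measurableType d} {T : measurableType dT}.
Variables (P : probability O R) (X : nat -> O -> T) (nu : probability T R).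
Hypothesis mX : forall j, measurable_fun setT (X j).
Hypothesis iX : independent_RVs P X.
Hypothesis Xnu : forall j A, measurable A -> P (X j @^-1` A) = nu A.

Lemma ge0_expectation_law j (g : T -> \bar R) :
  measurable_fun setT g -> (forall t, 0 <= g t) ->
  \int[P]_w g (X j w) = \int[nu]_t g t.
Proof.
move=> mg g0.
transitivity (\int[pushforward P (X j)]_t g t).
  by rewrite ge0_integral_pushforward.
by apply: eq_measure_integral => A mA _; exact: Xnu.
Qed.

Lemma ae_forall_law (A : set T) : measurable A -> nu A = 0 ->
  {ae P, forall w, forall j, ~ A (X j w)}.
Proof.
move=> mA A0; apply: ae_foralln => j.
exists (X j @^-1` A); split; [|exact: etrans (Xnu _ _ mA) A0|].
  by rewrite -[X in measurable X]setTI; exact: mX.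
by move=> w /= /contrapT.
Qed.

(** By the maximal inequality, the products of [Num.sqrt r / rho] ever reach [k.+1] with probability
    at most [k.+1%:R^-1]. Hence almost surely some [k] bounds the products of square roots by
    [k.+1%:R * rho ^+ n] for all [n], and squaring gives geometric decay. *)
Lemma ae_prod_cvg0 (r : T -> R) : measurable_fun setT r ->
  (forall t, (0 <= r t)%R) -> \int[nu]_t (Num.sqrt (r t))%:E < 1 ->
  {ae P, forall w, (\prod_(i < n) r (X i w))%R @[n --> \oo] --> 0%R}.
Proof.
move=> mr r0 s1.
have ms : measurable_fun setT (fun t => Num.sqrt (r t)).
  apply: measurableT_comp mr.
  by apply: continuous_measurable_fun => x; exact: sqrt_continuous.
have I0 : 0 <= \int[nu]_t (Num.sqrt (r t))%:E.
  by apply: integral_ge0 => t _; rewrite lee_fin.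
have [rho [rho0 rho1 srho]] : exists rho : R,
    [/\ (0 < rho)%R, (rho < 1)%R & \int[nu]_t (Num.sqrt (r t))%:E <= rho%:E].
  (* The maximum with [2^-1] keeps [rho] positive even if the affinity is [0]. *)
  exists (Num.max (2^-1)%R (fine (\int[nu]_t (Num.sqrt (r t))%:E))).
  have fI : \int[nu]_t (Num.sqrt (r t))%:E \is a fin_num.
    by rewrite ge0_fin_numE// (lt_trans s1)// ltry.
  split; first by rewrite lt_max invr_gt0 ltr0n.
    by rewrite gt_max -[X in _ && X]lte_fin fineK// s1 andbT; lra.
  by rewrite -[leLHS]fineK// lee_fin le_max lexx orbT.
(* Over a one-point parameter space with its Dirac measure, the mixture is a single product. *)
pose g (_ : unit) t := (Num.sqrt (r t) / rho)%R.
pose A k := \bigcup_n [set w | k.+1%:R%:E <=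
  \int[\d_tt]_phi (1 * \prod_(i < n) g phi (X i w))%:E].
have AE k : A k = \bigcup_n [set w | k.+1%:R%:E <=
    (\prod_(i < n) g tt (X i w))%:E].
  apply: eq_bigcupr => n _; apply/seteqP; split => w /=;
  by rewrite integral_dirac// diracT mul1e mul1r.
have mA k : measurable (A k).
  rewrite AE; apply: bigcupT_measurable => n.
  rewrite -[X in measurable X]setTI; apply: emeasurable_fun_c_infty => //.
  apply/measurable_EFinP; apply: measurable_prod => i _.
  by apply: measurable_funM => //; exact: (measurableT_comp ms (mX i)).
have mg phi : measurable_fun setT (g phi) by exact: measurable_funM.
have g0 phi t : (0 <= g phi t)%R by rewrite divr_ge0// ltW.
have g1 n phi : \int[P]_w (g phi (X n w))%:E <= 1.
  rewrite (ge0_expectation_law n (fun t => (g phi t)%:E)).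
  - under eq_integral do rewrite /g EFinM.
    rewrite ge0_integralZr//.
    + by rewrite -[leRHS]/(1%R%:E) -(divff (lt0r_neq0 rho0)) EFinM lee_wpmul2r//
        lee_fin invr_ge0 ltW.
    + exact/measurable_EFinP.
    + by rewrite lee_fin invr_ge0 ltW.
  - exact/measurable_EFinP.
  - by move=> t; rewrite lee_fin.
have kPA k : k.+1%:R%:E * P (A k) <= 1.
  have -> : 1 = \int[\d_tt]_(phi in [set: unit]) 1%:E :> \bar R.
    by rewrite integral_dirac// diracT mul1e.
  apply: (mixture_maximal_inequality \d_tt g (fun=> 1%R) _ _ mg g0 _ P X) => //.
  exact: countableP.
have : {ae P, forall w, exists k, ~ A k w}.
  apply: ae_exists_notin => // e e0.
  exists (Num.bound e^-1); have := kPA (Num.bound e^-1).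
  rewrite -lee_pdivlMl// mule1 => /le_trans; apply.
  rewrite lee_fin -[leRHS]invrK lef_pV2 ?posrE ?invr_gt0//.
  have /archi_boundP/ltW : (0 <= e^-1)%R by rewrite invr_ge0 ltW.
  by move/le_trans; apply; rewrite ler_nat.
apply: filterS => w [k]; rewrite AE => Ak.
have prodlt n : (\prod_(i < n) Num.sqrt (r (X i w)) <= k.+1%:R * rho ^+ n)%R.
  rewrite -ler_pdivrMr ?exprn_gt0//.
  have -> : (\prod_(i < n) Num.sqrt (r (X i w)) / rho ^+ n =
      \prod_(i < n) g tt (X i w))%R.
    by rewrite big_split/= prodr_const card_ord exprVn.
  by rewrite leNgt; apply/negP => /ltW h; apply: Ak; exists n.
apply: (@squeeze_cvgr _ _ _ _ (fun=> 0%R)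
  (fun n => (k.+1%:R ^+ 2 * (rho ^+ 2) ^+ n)%R)).
- apply: nearW => n; rewrite prodr_ge0//=.
  have -> : (\prod_(i < n) r (X i w) =
      (\prod_(i < n) Num.sqrt (r (X i w))) ^+ 2)%R.
    by rewrite -prodrXl; apply: eq_bigr => i _; rewrite sqr_sqrtr.
  rewrite exprAC -exprMn lerXn2r// ?nnegrE ?prodr_ge0//.
  by rewrite mulr_ge0// exprn_ge0// ltW.
- exact: cvg_cst.
- rewrite -[X in _ --> X](mulr0 (k.+1%:R ^+ 2)%R); apply: cvgMr.
  by apply: cvg_expr; rewrite ger0_norm ?sqr_ge0// expr_lt1// ltW.
Qed.
End iid.

(** * Joint control of all parameters other than [phi0] *)

Section mixture_cvg.
Context {R : realType} {d dT dP : measure_display}.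
Context {O : measurableType d} {T : measurableType dT}.
Context {Phi : measurableType dP}.
Variables (P : probability O R) (X : nat -> O -> T).
Variables (Q : probability Phi R) (r : Phi -> T -> R) (phi0 : Phi).
Hypothesis cPhi : countable [set: Phi].
Hypothesis mPhi : forall phi : Phi, measurable [set phi].
Hypothesis mX : forall j, measurable_fun setT (X j).
Hypothesis iX : independent_RVs P X.
Hypothesis mr : forall phi, measurable_fun setT (r phi).
Hypothesis r0 : forall phi t, (0 <= r phi t)%R.
Hypothesis r1 : forall n phi, \int[P]_w (r phi (X n w))%:E <= 1.

(** The parameters are enumerated and split at an index [N]. The tail contributes little for all [n]
    at once by the maximal inequality; the finitely many others are eventually small by hypothesis,
    and [Q] gives them mass at most [1]. *)
Lemma ae_mixture_cvg0 :
  (forall phi, phi <> phi0 ->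
    {ae P, forall w, (\prod_(i < n) r phi (X i w))%R @[n --> \oo] --> 0%R}) ->
  {ae P, forall w, \int[Q]_(phi in ~` [set phi0])
     (\prod_(i < n) r phi (X i w))%:E @[n --> \oo] --> 0}.
Proof.
move=> r_cvg0.
have mA (A : set Phi) : measurable A by exact: measurable_countableT.
have mF (A : set Phi) (f : Phi -> \bar R) : measurable_fun A f.
  by move=> _ B _; exact: mA.
have /countable_injP[idx /in2TT idxI] := cPhi.
(* As [idx] takes values in [nat], these tails decrease to the empty set. *)
pose D N := [set phi | phi <> phi0 /\ (N <= idx phi)%N].
have QD : Q (D N) @[N --> \oo] --> 0.
  rewrite -(measure0 Q) (_ : set0 = \bigcap_N D N).
    apply: nonincreasing_cvg_mu => //.
    - by rewrite (le_lt_trans (probability_le1 _ _))// ltry.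
    - by move=> m n mn; apply/subsetPset => phi [? ?]; split => //;
        exact: leq_trans mn _.
  apply/esym; rewrite -subset0 => phi /(_ (idx phi).+1 I)[_].
  by rewrite ltnn.
pose L n phi w := (\prod_(i < n) r phi (X i w))%R.
have L0 n phi w : (0 <= L n phi w)%R by exact: prodr_ge0.
(* The order of quantifiers matters: [N] depends on the outcome but not on the sample size. *)
have tail k : {ae P, forall w, exists N, forall n,
    \int[Q]_(phi in D N) (L n phi w)%:E <= k.+1%:R^-1%:E}.
  pose A N := \bigcup_n [set w | k.+1%:R^-1%:E <=
    \int[Q]_phi (\1_(D N) phi * \prod_(i < n) r phi (X i w))%:E].
  have AE N n w : \int[Q]_phi (\1_(D N) phi * \prod_(i < n) r phi (X i w))%:E =
      \int[Q]_(phi in D N) (L n phi w)%:E.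
    rewrite [RHS]integral_mkcond; apply: eq_integral => phi _.
    by rewrite epatch_indic EFinM muleC.
  have mL n phi : measurable_fun setT (L n phi).
    by apply: measurable_prod => i _; exact: (measurableT_comp (mr phi) (mX i)).
  have mAN N : measurable (A N).
    apply: bigcupT_measurable => n.
    rewrite -[X in measurable X]setTI; apply: emeasurable_fun_c_infty => //.
    apply: (measurable_fun_fubini_tonelli_G (fun z : Phi * O =>
      (\1_(D N) z.1 * L n z.1 z.2)%:E)).
    - apply: (measurable_fun_countable_prod
        (fun phi w => (\1_(D N) phi * L n phi w)%:E)) => // phi.
      by apply/measurable_EFinP; exact: measurable_funM.
    - by move=> z; rewrite lee_fin mulr_ge0.
  have PA N : k.+1%:R^-1%:E * P (A N) <= Q (D N).
    apply: le_trans (_ : _ <= \int[Q]_phi (\1_(D N) phi)%:E) _.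
      exact: (mixture_maximal_inequality Q r (\1_(D N)) _ _ mr r0 _ P X).
    by rewrite integral_indic// setIT.
  have : {ae P, forall w, exists N, ~ A N w}.
    apply: ae_exists_notin => // e e0.
    have : \forall N \near \oo, Q (D N) < (k.+1%:R^-1 * e)%:E.
      have c0 : (0 < k.+1%:R^-1 * e)%R by rewrite mulr_gt0// invr_gt0.
      have /fine_cvgP[_ /cvgr0Pnorm_lt/(_ _ c0)] := QD.
      apply: filterS => N; rewrite /= ger0_norm ?fine_ge0// -lte_fin fineK//.
      exact: fin_num_measure.
    case=> N _ /(_ N (leqnn N)) /= QN; exists N.
    have := le_lt_trans (PA N) QN.
    by rewrite EFinM lte_pmul2l// => /ltW.
  apply: filterS => w [N AN]; exists N => n.
  rewrite leNgt; apply/negP => /ltW; rewrite -AE => h.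
  by apply: AN; exists n.
have head : {ae P, forall w, forall phi, phi <> phi0 ->
    (L n phi w) @[n --> \oo] --> 0%R}.
  apply: ae_forall_countable => // phi.
  have [->|phiN] := pselect (phi = phi0); first exact: aeW.
  by apply: filterS (r_cvg0 _ phiN).
have {}tail := ae_foralln tail.
move: tail head; apply: filterS2 => w tail head.
apply: cvge0_ge0P => [n|e e0].
  by apply: integral_ge0 => phi _; rewrite lee_fin; exact: L0.
have [k ke] : exists k : nat, (k.+1%:R^-1 <= e / 2)%R.
  exists (Num.bound (e / 2)^-1).
  rewrite -[leRHS]invrK lef_pV2 ?posrE ?invr_gt0 ?divr_gt0//.
  have /archi_boundP/ltW : (0 <= (e / 2)^-1)%R.
    by rewrite invr_ge0 divr_ge0 ?ltW.
  by move/le_trans; apply; rewrite ler_nat.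
have e2 : (0 < e / 2)%R by rewrite divr_gt0.
have [N DN] := tail k.
have : \forall n \near \oo, forall phi, phi <> phi0 -> (idx phi < N)%N ->
    (L n phi w <= e / 2)%R.
  elim: {DN} N => [|N IH]; first exact: nearW.
  have HN : \forall n \near \oo, forall phi, phi <> phi0 -> idx phi = N ->
      (L n phi w <= e / 2)%R.
    have [[phi [phiN <-]]|H] :=
      pselect (exists phi, phi <> phi0 /\ idx phi = N).
      have /cvgr0Pnorm_le/(_ _ e2) := head _ phiN.
      by apply: filterS => n h psi _ /idxI ->; rewrite -[leLHS]ger0_norm.
    by apply: nearW => n phi ? ?; exfalso; apply: H; exists phi.
  move: HN IH; apply: filterS2 => n HN IH phi phiN.
  by rewrite ltnS leq_eqVlt => /predU1P[|]; [exact: HN|exact: IH].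
apply: filterS => n Hn.
pose B := [set phi | phi <> phi0 /\ (idx phi < N)%N].
have -> : ~` [set phi0] = B `|` D N.
  apply/seteqP; split => phi /=; last by move=> [] [].
  by move=> ?; have [] := ltnP (idx phi) N; [left|right].
rewrite ge0_integral_setU//; last 2 first.
  by move=> phi _; rewrite lee_fin L0.
  by apply/disj_setPS => phi [] [_ +] [_]; rewrite ltnNge => /negP.
rewrite [in leRHS](splitr e) EFinD leeD//.
  apply: le_trans (_ : _ <= \int[Q]_(phi in B) (e / 2)%:E) _.
    apply: ge0_le_integral => //.
    - by move=> phi _; rewrite lee_fin L0.
    - by move=> phi [? ?]; rewrite lee_fin Hn.
  rewrite integral_cst// -[leRHS]mule1 lee_wpmul2l ?lee_fin ?(ltW e2)//.
  exact: probability_le1.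
by apply: le_trans (DN n) _; rewrite lee_fin.
Qed.
End mixture_cvg.

Lemma cvg_ratio1 {R : realType} (q : R) (v : nat -> \bar R) : (0 < q)%R ->
  (forall n, 0 <= v n) -> v @ \oo --> 0 ->
  q%:E / (q%:E + v n) @[n --> \oo] --> 1.
Proof.
move=> q0 v0 /fine_cvgP[vfin v_cvg].
have E : \forall n \near \oo,
    (q / (q + fine (v n)))%:E = q%:E / (q%:E + v n).
  apply: filterS vfin => n vn; rewrite -[in RHS](fineK vn) -EFinD inver.
  by rewrite gt_eqF ?ltr_wpDr ?fine_ge0// EFinM.
apply: cvg_trans (near_eq_cvg E) _.
apply: cvg_EFin; first exact: nearW.
rewrite (_ : 1%R = q / (q + 0))%R; last by rewrite addr0 divff// gt_eqF.
apply: cvgMr; apply: cvgV; first by rewrite addr0 gt_eqF.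
by apply: cvgD => //; exact: cvg_cst.
Qed.

(** * Posterior concentration for extended-real likelihoods *)

Section consistency.
Context {R : realType} {d dT dP : measure_display}.
Context {O : measurableType d} {T : measurableType dT}.
Context {Phi : measurableType dP}.
Variables (P : probability O R) (X : nat -> O -> T).
Variables (Q : probability Phi R) (kappa : {measure set T -> \bar R}).
Variables (m : Phi -> T -> \bar R) (c : R) (nu : Phi -> probability T R).
Variable phi0 : Phi.
Hypothesis cPhi : countable [set: Phi].
Hypothesis mPhi : forall phi : Phi, measurable [set phi].
Hypothesis mX : forall j, measurable_fun setT (X j).
Hypothesis iX : independent_RVs P X.
Hypothesis mm : forall phi, measurable_fun setT (m phi).
Hypothesis m0 : forall phi t, 0 <= m phi t.
Hypothesis c0 : (0 < c)%R.
Hypothesis nuE : forall phi A, measurable A ->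
  nu phi A = \int[kappa]_(t in A) (c%:E * m phi t).
Hypothesis Xnu : forall j A, measurable A -> P (X j @^-1` A) = nu phi0 A.
Hypothesis identifiable : forall phi, phi <> phi0 ->
  exists2 A, measurable A & nu phi0 A != nu phi A.
Hypothesis Q0 : 0 < Q [set phi0].

Let mI phi : measurable [set t | m phi t = +oo].
Proof.
rewrite -[X in measurable X]setTI.
exact: (mm phi measurableT [set +oo] (emeasurable_set1 _)).
Qed.

Let kappa_infty phi : kappa [set t | m phi t = +oo] = 0.
Proof.
have mcm : measurable_fun setT (fun t => c%:E * m phi t).
  exact: measurable_funeM.
have : kappa.-integrable setT (fun t => c%:E * m phi t).
  apply/integrableP; split => //.
  under eq_integral do rewrite gee0_abs ?mule_ge0 ?lee_fin ?(ltW c0)//.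
  by rewrite -nuE// probability_setT ltry.
move=> /(integrable_ae measurableT)/negligible_null_set; apply => //.
by move=> t /= moo /(_ I); rewrite moo gt0_muley// lte_fin.
Qed.

(** A real-valued version of the density of [nu phi]. It differs from [c%:E * m phi t] only where
    [m phi] is infinite, a [kappa]-null set because the density has total mass [1]. *)
Let f phi t : R := (c * fine (m phi t))%R.

Let mf phi : measurable_fun setT (f phi).
Proof. by apply: measurable_funM => //; exact: measurableT_comp. Qed.

Let f0 phi t : (0 <= f phi t)%R.
Proof. by rewrite mulr_ge0 ?fine_ge0// ltW. Qed.

Let nu_density phi A : measurable A ->
  nu phi A = \int[kappa]_(t in A) (f phi t)%:E.
Proof.
move=> mA; rewrite nuE//; apply: ae_eq_integral => //.
- exact/measurable_funTS/measurable_funeM.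
- exact/measurable_funTS/measurable_EFinP.
- exists [set t | m phi t = +oo]; split => // t /=.
  apply: contra_notP => /eqP moo _; rewrite /f EFinM fineK//.
  by rewrite ge0_fin_numE// lt_neqAle moo leey.
Qed.

Let r phi t : R := (f phi t / f phi0 t)%R.

(** Dividing numerator and denominator by the likelihood of [phi0] leaves [q / (q + v n)], where [q]
    is the prior mass of [phi0] and [v n] is the mixture of the ratio products over the other
    parameters. *)
Lemma ae_posterior_cvg1 :
  {ae P, forall w,
    (\int[Q]_(phi in [set phi0]) \prod_(i < n) m phi (X i w)) /
    (\int[Q]_phi \prod_(i < n) m phi (X i w)) @[n --> \oo] --> 1}.
Proof.
have mA (A : set Phi) : measurable A by exact: measurable_countableT.
have mF (A : set Phi) (g : Phi -> \bar R) : measurable_fun A g.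
  by move=> _ B _; exact: mA.
have mr phi : measurable_fun setT (r phi) by exact: measurable_likelihood_ratio.
have r0 phi t : (0 <= r phi t)%R by exact: divr_ge0.
have ratio_cvg : {ae P, forall w, \int[Q]_(phi in ~` [set phi0])
     (\prod_(i < n) r phi (X i w))%:E @[n --> \oo] --> 0}.
  apply: (ae_mixture_cvg0 P X Q r phi0) => //.
  - move=> n phi; rewrite (ge0_expectation_law P X (nu phi0) mX Xnu n
      (fun t => (r phi t)%:E))//.
    + rewrite -(probability_setT (nu phi)).
      by apply: (integral_likelihood_ratio_le kappa (nu phi0) (nu phi) (f phi0)
        (f phi)) => // A; exact: nu_density.
    + exact/measurable_EFinP.
    + by move=> t; rewrite lee_fin.
  - move=> phi phiN; apply: (ae_prod_cvg0 P X (nu phi0)) => //.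
    have [A mA' nA] := identifiable _ phiN.
    by apply: (hellinger_affinity_lt1 kappa (nu phi0) (nu phi) (f phi0) (f phi)
      _ _ _ _ _ _ A) => // B; exact: nu_density.
(* Outside a null event all likelihoods are finite and that of [phi0] is positive, which makes the
   division legitimate. Countability of [Phi] allows one null event for all parameters. *)
have fin_m : {ae P, forall w, forall phi j, m phi (X j w) <> +oo}.
  apply: ae_forall_countable => // phi.
  apply: (ae_forall_law P X (nu phi0) mX Xnu [set t | m phi t = +oo]) => //.
  rewrite nuE//; apply: null_set_integral => //.
  exact/measurable_funTS/measurable_funeM.
have f_neq0 : {ae P, forall w, forall j, f phi0 (X j w) <> 0%R}.
  apply: (ae_forall_law P X (nu phi0) mX Xnu [set t | f phi0 t = 0%R]).
    rewrite -[X in measurable X]setTI.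
    exact: (mf phi0 measurableT [set 0%R]).
  by apply: (density_neq0 kappa (nu phi0) (f phi0)) => // A; exact: nu_density.
move: ratio_cvg; apply: filterS3 fin_m f_neq0 => w fin_m f_neq0 ratio_cvg.
have mE phi j : m phi (X j w) = (fine (m phi (X j w)))%:E.
  by rewrite fineK// ge0_fin_numE// lt_neqAle leey andbT; apply/eqP.
pose a n : R := (\prod_(i < n) fine (m phi0 (X i w)))%R.
have m_gt0 i : (0 < fine (m phi0 (X i w)))%R.
  rewrite lt_neqAle fine_ge0// andbT eq_sym; apply/eqP => m00.
  by apply: (f_neq0 i); rewrite /f m00 mulr0.
have a0 n : (0 < a n)%R by apply: prodr_gt0.
pose L n phi : R := (\prod_(i < n) r phi (X i w))%R.
have L0 n phi : (0 <= L n phi)%R by exact: prodr_ge0.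
have prodE n phi : \prod_(i < n) m phi (X i w) = (a n)%:E * (L n phi)%:E.
  under eq_bigr do rewrite mE.
  rewrite prodEFin -EFinM /a /L -big_split/=; congr EFin.
  apply: eq_bigr => i _; rewrite /r /f -mulf_div divff ?gt_eqF// mul1r.
  by rewrite mulrC divfK// gt_eqF.
have intE n A : \int[Q]_(phi in A) \prod_(i < n) m phi (X i w) =
    (a n)%:E * \int[Q]_(phi in A) (L n phi)%:E.
  under eq_integral do rewrite prodE.
  rewrite ge0_integralZl_EFin//; last exact: ltW.
  by move=> phi _; rewrite lee_fin.
have L1 n : \int[Q]_(phi in [set phi0]) (L n phi)%:E = Q [set phi0].
  rewrite -[RHS]mul1e -integral_cst//; apply: eq_integral => phi.
  rewrite inE => ->; rewrite /L big1// => i _.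
  by rewrite /r divff//; apply/eqP; exact: f_neq0.
have LT n : \int[Q]_phi (L n phi)%:E =
    Q [set phi0] + \int[Q]_(phi in ~` [set phi0]) (L n phi)%:E.
  rewrite -(setUv [set phi0]) ge0_integral_setU//; first by rewrite L1.
    by move=> phi _; rewrite lee_fin.
  by apply/disj_setPCl.
have I0 n (A : set Phi) : 0 <= \int[Q]_(phi in A) (L n phi)%:E.
  by apply: integral_ge0 => phi _; rewrite lee_fin.
under eq_fun do rewrite !intE ratio_scale// L1 LT.
have fQ : Q [set phi0] \is a fin_num by exact: fin_num_measure.
rewrite -(fineK fQ); apply: cvg_ratio1 => //.
by rewrite fine_gt0// Q0 ltey_eq fQ.
Qed.
End consistency.

(** * Application to the superposterior *)

(** The identity on the space of probability measures is a kernel, and the integral of a nonnegative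
    measurable function along a kernel is measurable in the kernel's argument. *)
Lemma measurable_marginal_lik {R : realType} {dT dP : measure_display}
    {Theta : measurableType dT} {Phi : measurableType dP}
    (p : Phi -> Theta -> R) phi :
  measurable_fun setT (p phi) -> (forall theta, (0 <= p phi theta)%R) ->
  measurable_fun setT (marginal_lik p phi).
Proof.
move=> mp p0; apply: (@measurable_fun_integral_kernel _ _
  (pprobability Theta R) Theta R (fun Pi => Pi)).
- move=> U mU.
  exact: (measurable_kernel (kprobability (@measurable_id _ _ setT)) U mU).
- by move=> theta; rewrite lee_fin.
- exact/measurable_EFinP.
Qed.

Theorem theoremB2 (R : realType) (dT dP dO : measure_display)
  (Theta : measurableType dT) (Phi : measurableType dP)
  (Omega : measurableType dO)
  (lambda : {measure set Theta -> \bar R})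
  (p : Phi -> Theta -> R)
  (Q : probability Phi R)
  (kappa : {measure set (pprobability Theta R) -> \bar R})
  (C : nat -> R)
  (H : nat -> Phi -> probability (pprobability Theta R) R)
  (P : probability Omega R)
  (X : nat -> {RV P >-> pprobability Theta R})
  (phi0 : Phi)
  (mu sigma : Phi -> nat -> R)
  (Theta_borel : borel_space R Theta)
  (Phi_points : forall phi : Phi, measurable [set phi])
  (p_measurable : forall phi, measurable_fun [set: Theta] (p phi))
  (p_ge0 : forall phi theta, (0 <= p phi theta)%R)
  (p_density : forall phi, \int[lambda]_theta (p phi theta)%:E = 1)
  (C_gt0 : forall j, (0 < C j)%R)
  (H_density : forall j phi (A : set (pprobability Theta R)), measurable A ->
     H j phi A = \int[kappa]_(Pi in A) h p C j phi Pi)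
  (Phi_countable : countable [set: Phi])
  (Q_phi0 : 0 < Q [set phi0])
  (KL_gt0 : forall j,
     0 < ereal_inf [set KL (H j phi0) (H j phi) | phi in ~` [set phi0]])
  (xi_indep : forall phi, phi <> phi0 ->
     independent_RVs P (fun j w => log_lik_ratio p C j phi0 phi (X j w)))
  (xi_integrable : forall phi, phi <> phi0 -> forall j,
     P.-integrable [set: Omega]
       (fun w => log_lik_ratio p C j phi0 phi (X j w)))
  (xi_mean : forall phi, phi <> phi0 -> forall j,
     \int[P]_w log_lik_ratio p C j phi0 phi (X j w) = (mu phi j)%:E)
  (xi_var : forall phi, phi <> phi0 -> forall j,
     \int[P]_w ((log_lik_ratio p C j phi0 phi (X j w) - (mu phi j)%:E) ^+ 2)
     = (sigma phi j ^+ 2)%:E)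
  (xi_var_sum : forall phi, phi <> phi0 ->
     \sum_(0 <= j <oo) (sigma phi j ^+ 2 / j.+1%:R ^+ 2)%:E < +oo)
  (X_indep : independent_RVs P (fun j w => X j w))
  (X_distr : forall j (A : set (pprobability Theta R)), measurable A ->
     distribution P (X j) A = H j phi0 A) :
  {ae P, forall w,
     (fun J : nat => superposterior p Q J (fun j => X j w) [set phi0])
       @ \oo --> 1}.
Proof.
have m0 phi Pi : 0 <= marginal_lik p phi Pi.
  by apply: integral_ge0 => theta _; rewrite lee_fin.
have mm phi : measurable_fun setT (marginal_lik p phi).
  exact: measurable_marginal_lik.
(* Each [C k] times the same integral of the marginal likelihood of [phi0] is the total mass [1],
   which forces that integral to be finite and nonzero. *)
have C_const j : C j = C 0%N.
  have CI k : (C k)%:E * \int[kappa]_Pi marginal_lik p phi0 Pi = 1.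
    rewrite -ge0_integralZl_EFin//; last exact: ltW.
    by rewrite -(probability_setT (H k phi0)) H_density.
  have := CI 0%N; rewrite -(CI j).
  have := CI j; case: (\int[kappa]_Pi marginal_lik p phi0 Pi) => [i| |].
  - move=> [Ci1] [] /mulIf ->//; apply/eqP => i0; move: Ci1.
    by rewrite i0 mulr0 => /eqP; rewrite eq_sym oner_eq0.
  - by rewrite gt0_muley// lte_fin.
  - by rewrite gt0_muleNy// lte_fin.
have HE j phi A : measurable A ->
    H j phi A = \int[kappa]_(Pi in A) ((C 0%N)%:E * marginal_lik p phi Pi).
  by move=> mA; rewrite H_density// /h C_const.
apply: (ae_posterior_cvg1 P X Q kappa (marginal_lik p) (C 0%N) (H 0%N) phi0)
  => //.
- by move=> phi A; exact: HE.
- by move=> j A mA; rewrite HE// -(HE j)//; exact: X_distr.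
move=> phi phiN.
(* If no set separated the two laws, their divergence would be [0], against the positive infimum. *)
have [//|H_eq] :=
  pselect (exists2 A, measurable A & H 0%N phi0 A != H 0%N phi A).
have KL0 : KL (H 0%N phi0) (H 0%N phi) = 0.
  apply: KL_eq0 => A mA; apply/eqP; apply: contra_notT H_eq => ?.
  by exists A.
have := KL_gt0 0%N; rewrite ltNge -[X in _ <= X]KL0 => /negP; case.
by apply: ereal_inf_lbound; exists phi.
Qed.
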